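(* Let $(M,g)$ be a Riemannian manifold and let $T^1_1(M)$ be its $(1,1)$-tensor bundle with the rescaled Sasaki type metric ${}^Sg_f$. The curvature tensor ${}^{(M)}\widetilde R$ of the metric connection ${}^{(M)}\widetilde\nabla$ satisfies, with respect to the adapted frame, $${}^{(M)}\widetilde R(E_m,E_l)E_j=\Big\{R_{mlj}{}^{r}+\nabla_m\big(\tfrac1{2f}{}^fA_{lj}^r\big)-\nabla_l\big(\tfrac1{2f}{}^fA_{mj}^r\big)+\tfrac1{4f^2}{}^fA_{ms}^r\,{}^fA_{lj}^s-\tfrac1{4f^2}{}^fA_{ls}^r\,{}^fA_{mj}^s\Big\}E_r,$$ $${}^{(M)}\widetilde R(E_m,E_l)E_{\bar j}=\Big\{R_{mli}{}^{v}\delta_r^j-R_{mlr}{}^{j}\delta_i^v\Big\}E_{\bar r},$$ and all other components vanish, i.e. ${}^{(M)}\widetilde R(E_\alpha,E_\beta)E_\gamma=0$ whenever at least one of $E_\alpha,E_\beta$ is vertical.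
   Context: All objects are smooth; Einstein summation. $\Gamma_{ij}^h$ are the Christoffel symbols of the Levi-Civita connection $\nabla$ of $g$; $R(X,Y)=[\nabla_X,\nabla_Y]-\nabla_{[X,Y]}$ and $R(\partial_k,\partial_l)\partial_j=R_{klj}{}^{s}\partial_s$ (same curvature convention for ${}^{(M)}\widetilde R$). $f>0$ is a smooth function on $M$ (also viewed on the bundle by pullback). ${}^fA_{ji}^h=f_j\delta_i^h+f_i\delta_j^h-f^hg_{ji}$ with $f_i=\partial_if$, $f^h=g^{hm}f_m$. $T^1_1(M)$ is the bundle of $(1,1)$-tensors, with induced local coordinates $(x^j,t_j^i)$, a point being $t=t_j^i\,\partial_i\otimes dx^j$ at $x$. The vertical lift of a $(1,1)$-tensor field $A$ is ${}^VA=A_j^i\,\partial/\partial t_j^i$; the horizontal lift of a vector field $X$ is ${}^HX=X^j\partial/\partial x^j+X^s(\Gamma_{sj}^mt_m^i-\Gamma_{sm}^it_j^m)\,\partial/\partial t_j^i$. The metric is ${}^Sg_f({}^VA,{}^VB)=g_{ic}g^{jl}A_j^iB_l^c$, ${}^Sg_f({}^VA,{}^HY)=0$, ${}^Sg_f({}^HX,{}^HY)=f\,g(X,Y)$. Adapted frame: $E_j={}^H(\partial_j)$ (horizontal) and $E_{\bar j}={}^V(\partial_i\otimes dx^j)$ (vertical), where $\bar j$ stands for the pair $(i,j)$; similarly $E_{\bar l}={}^V(\partial_c\otimes dx^l)$, $E_{\bar r}={}^V(\partial_v\otimes dx^r)$, with summation over both $v$ and $r$ when $E_{\bar r}$ is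 summed. The metric connection ${}^{(M)}\widetilde\nabla$ (with torsion, satisfying ${}^{(M)}\widetilde\nabla\,{}^Sg_f=0$) is given by ${}^{(M)}\widetilde\nabla_{E_l}E_j=\{\Gamma_{lj}^r+\frac1{2f}{}^fA_{lj}^r\}E_r$, ${}^{(M)}\widetilde\nabla_{E_l}E_{\bar j}=\{\Gamma_{li}^v\delta_r^j-\Gamma_{lr}^j\delta_i^v\}E_{\bar r}$, ${}^{(M)}\widetilde\nabla_{E_{\bar l}}E_j=0$, ${}^{(M)}\widetilde\nabla_{E_{\bar l}}E_{\bar j}=0$. *)

(* Defs.v *)
From HB Require Import structures.
From mathcomp Require Import all_boot all_order all_algebra.
From mathcomp Require Import boolp classical_sets functions reals.
From mathcomp Require Import topology normedtype derive.

Set Implicit Arguments.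
Unset Strict Implicit.
Unset Printing Implicit Defensive.

Import Order.TTheory GRing.Theory Num.Theory.
Import numFieldNormedType.Exports.

Local Open Scope ring_scope.
Local Open Scope classical_set_scope.

(** * Smooth maps between normed spaces *)

(* C^k on an open set U; in finite dimension x |-> dF_x is C^k iff all the
   maps x |-> dF_x(v) are. *)
Fixpoint Ck_on (R : realType) (V W : normedModType R) (k : nat)
    (U : set V) (F : V -> W) : Prop :=
  if k is k'.+1 then
    (forall x, U x -> differentiable F x) /\
    (forall v : V, Ck_on k' U (fun x => 'D_v F x))
  else forall x, U x -> {for x, continuous F}.

Definition smooth_on (R : realType) (V W : normedModType R)
    (U : set V) (F : V -> W) : Prop := forall k, Ck_on k U F.

(** * Calculus in one chart

   A chart of N is a map to a normed space E, meaningful (and injective) on its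
   domain only.  Vector fields on the domain are given by their components in
   the natural frame of the chart, i.e. as functions N -> E; nothing is ever
   required of functions and fields outside of the domain. *)

Record local_chart (N : Type) (E : Type) := LocalChart {
  chart_dom : set N;
  chart_map : N -> E }.

(* h \o c^-1, extended by 0 outside of the image of the domain *)
Definition local_expr (R : realType) (N : Type) (E W : normedModType R)
    (c : local_chart N E) (h : N -> W) : E -> W :=
  fun x => xget 0
    [set w | exists2 p, chart_dom c p & chart_map c p = x /\ w = h p].

Definition smooth_in (R : realType) (N : Type) (E W : normedModType R)
    (c : local_chart N E) (h : N -> W) : Prop :=
  smooth_on (chart_map c @` chart_dom c) (local_expr c h).

(* X(h) = X^a d_a h, componentwise if h is vector-valued *)
Definition der (R : realType) (N : Type) (E W : normedModType R)
    (c : local_chart N E) (X : N -> E) (h : N -> W) : N -> W :=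
  fun p => 'D_(X p) (local_expr c h) (chart_map c p).

(* [X, Y]^b = X^a d_a Y^b - Y^a d_a X^b *)
Definition lie_bracket (R : realType) (N : Type) (E : normedModType R)
    (c : local_chart N E) (X Y : N -> E) : N -> E :=
  fun p => der c X Y p - der c Y X p.

Definition field_eq (N E E' : Type) (c : local_chart N E) (X Y : N -> E') :
    Prop :=
  forall p, chart_dom c p -> X p = Y p.

Record affine_connection (R : realType) (N : Type) (E : normedModType R)
    (c : local_chart N E) (D : (N -> E) -> (N -> E) -> (N -> E)) : Prop := {
  conn_smooth : forall X Y, smooth_in c X -> smooth_in c Y ->
    smooth_in c (D X Y);
  conn_addl : forall X X' Y,
    smooth_in c X -> smooth_in c X' -> smooth_in c Y ->
    field_eq c (D (fun p => X p + X' p) Y) (fun p => D X Y p + D X' Y p);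
  conn_scalel : forall (h : N -> R) X Y,
    smooth_in c h -> smooth_in c X -> smooth_in c Y ->
    field_eq c (D (fun p => h p *: X p) Y) (fun p => h p *: D X Y p);
  conn_addr : forall X Y Y',
    smooth_in c X -> smooth_in c Y -> smooth_in c Y' ->
    field_eq c (D X (fun p => Y p + Y' p)) (fun p => D X Y p + D X Y' p);
  conn_leibniz : forall (h : N -> R) X Y,
    smooth_in c h -> smooth_in c X -> smooth_in c Y ->
    field_eq c (D X (fun p => h p *: Y p))
      (fun p => der c X h p *: Y p + h p *: D X Y p) }.

(* R(X, Y) Z = [D_X, D_Y] Z - D_[X, Y] Z *)
Definition curvature (R : realType) (N : Type) (E : normedModType R)
    (c : local_chart N E) (D : (N -> E) -> (N -> E) -> (N -> E))
    (X Y Z : N -> E) : N -> E :=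
  fun p => D X (D Y Z) p - D Y (D X Z) p - D (lie_bracket c X Y) Z p.

(** * Riemannian manifolds *)

Record smooth_manifold (R : realType) (n : nat) := SmoothManifold {
  carrier :> topologicalType;
  atlas : Type;
  chart : atlas -> local_chart carrier 'rV[R]_n;
  manifold_hausdorff : hausdorff_space carrier;
  manifold_second_countable : @second_countable carrier;
  chart_cover : forall p, exists a, chart_dom (chart a) p;
  chart_open : forall a, open (chart_dom (chart a));
  chart_inj : forall a p q, chart_dom (chart a) p -> chart_dom (chart a) q ->
    chart_map (chart a) p = chart_map (chart a) q -> p = q;
  chart_continuous : forall a p, chart_dom (chart a) p ->
    {for p, continuous (chart_map (chart a))};
  chart_open_map : forall a (V : set carrier),
    open V -> V `<=` chart_dom (chart a) -> open (chart_map (chart a) @` V);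
  chart_transition : forall a b,
    smooth_on
      (chart_map (chart a) @` (chart_dom (chart a) `&` chart_dom (chart b)))
      (local_expr (chart a) (chart_map (chart b))) }.

(* row i, column k: dy^k / dx^i, for x the coordinates of a and y those of b *)
Definition jac (R : realType) (n : nat) (M : smooth_manifold R n)
    (a b : atlas M) (p : M) : 'M[R]_n :=
  jacobian (local_expr (chart a) (chart_map (chart b))) (chart_map (chart a) p).

Definition smooth_fun (R : realType) (n : nat) (M : smooth_manifold R n)
    (f : M -> R) : Prop := forall a, smooth_in (chart a) f.

(* metric a p = (g_ij(p)), components in the chart a *)
Record riemannian_metric (R : realType) (n : nat) (M : smooth_manifold R n) :=
  RiemannianMetric {
    metric : atlas M -> M -> 'M[R]_n;
    metric_smooth : forall a, smooth_in (chart a) (metric a);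
    metric_sym : forall a p, chart_dom (chart a) p ->
      (metric a p)^T = metric a p;
    metric_pos : forall a p (v : 'rV[R]_n), chart_dom (chart a) p -> v != 0 ->
      0 < (v *m metric a p *m v^T) 0 0;
    metric_law : forall a b p,
      chart_dom (chart a) p -> chart_dom (chart b) p ->
      metric a p = jac a b p *m metric b p *m (jac a b p)^T }.

(* the coordinate vector field d_i *)
Definition coord_field (R : realType) (n : nat) (M : smooth_manifold R n)
    (i : 'I_n) : M -> 'rV[R]_n := fun=> delta_mx 0 i.

Definition pder (R : realType) (n : nat) (M : smooth_manifold R n)
    (a : atlas M) (i : 'I_n) (h : M -> R) : M -> R :=
  der (chart a) (@coord_field R n M i) h.

Definition inv_metric (R : realType) (n : nat) (M : smooth_manifold R n)
    (g : riemannian_metric M) (a : atlas M) (p : M) : 'M[R]_n :=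
  invmx (metric g a p).

(* christoffel g a i j h = Gamma_ij^h; in all coefficients below, the upper
   index comes last. *)
Definition christoffel (R : realType) (n : nat) (M : smooth_manifold R n)
    (g : riemannian_metric M) (a : atlas M) (i j h : 'I_n) (p : M) : R :=
  2^-1 * \sum_(m < n) inv_metric g a p h m *
    (pder a i (fun x => metric g a x m j) p
     + pder a j (fun x => metric g a x m i) p
     - pder a m (fun x => metric g a x i j) p).

Definition levi_civita (R : realType) (n : nat) (M : smooth_manifold R n)
    (g : riemannian_metric M) (a : atlas M) (X Y : M -> 'rV[R]_n) :
    M -> 'rV[R]_n :=
  fun p => der (chart a) X Y p +
    \row_(h < n) \sum_(i < n) \sum_(j < n)
      X p 0 i * Y p 0 j * christoffel g a i j h p.

(* R_klj^s, where R(d_k, d_l) d_j = R_klj^s d_s *)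
Definition riemann (R : realType) (n : nat) (M : smooth_manifold R n)
    (g : riemannian_metric M) (a : atlas M) (k l j s : 'I_n) (p : M) : R :=
  curvature (chart a) (levi_civita g a) (@coord_field R n M k)
    (@coord_field R n M l) (@coord_field R n M j) p 0 s.

(* nabla_m S_lj^r for a (1,2)-tensor field with components S l j r = S_lj^r *)
Definition cov12 (R : realType) (n : nat) (M : smooth_manifold R n)
    (g : riemannian_metric M) (a : atlas M) (S : 'I_n -> 'I_n -> 'I_n -> M -> R)
    (m l j r : 'I_n) (p : M) : R :=
  pder a m (S l j r) p
  + \sum_(s < n) christoffel g a m s r p * S l j s p
  - \sum_(s < n) christoffel g a m l s p * S s j r p
  - \sum_(s < n) christoffel g a m j s p * S l s r p.

(* ^fA_ji^h = f_j delta_i^h + f_i delta_j^h - f^h g_ji *)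
Definition fA (R : realType) (n : nat) (M : smooth_manifold R n)
    (g : riemannian_metric M) (f : M -> R) (a : atlas M) (j i h : 'I_n)
    (p : M) : R :=
  pder a j f p * (i == h)%:R + pder a i f p * (j == h)%:R
  - (\sum_(m < n) inv_metric g a p h m * pder a m f p) * metric g a p j i.

(** * The bundle of (1,1)-tensors *)

(* A point (p, t) of the total space: t is given by its components in all the
   charts around p, (tcomp t a) i j = t_j^i; components in the other charts are
   set to 0, so that equality of points is equality of tensors. *)
Record tensor11 (R : realType) (n : nat) (M : smooth_manifold R n) := Tensor11 {
  tbase : M;
  tcomp : atlas M -> 'M[R]_n;
  tcomp_law : forall a b,
    chart_dom (chart a) tbase -> chart_dom (chart b) tbase ->
    tcomp b = (jac a b tbase)^T *m tcomp a *m (jac b a tbase)^T;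
  tcomp_out : forall a, ~ chart_dom (chart a) tbase -> tcomp a = 0 }.

(* the induced coordinates (x^j, t_j^i) on the preimage of the domain of a *)
Definition tchart (R : realType) (n : nat) (M : smooth_manifold R n)
    (a : atlas M) : local_chart (tensor11 M) ('rV[R]_n * 'M[R]_n)%type :=
  LocalChart [set t : tensor11 M | chart_dom (chart a) (tbase t)]
    (fun t => (chart_map (chart a) (tbase t), tcomp t a)).

Definition vlift (R : realType) (n : nat) (M : smooth_manifold R n)
    (A : M -> 'M[R]_n) : tensor11 M -> ('rV[R]_n * 'M[R]_n)%type :=
  fun t => (0, A (tbase t)).

(* d/dt_j^i-components of the horizontal lift to t of a tangent vector v *)
Definition hlift_fibre (R : realType) (n : nat) (M : smooth_manifold R n)
    (g : riemannian_metric M) (a : atlas M) (t : tensor11 M) (v : 'rV[R]_n) :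
    'M[R]_n :=
  \matrix_(i < n, j < n) \sum_(s < n) v 0 s * \sum_(m < n)
    (christoffel g a s j m (tbase t) * tcomp t a i m
     - christoffel g a s m i (tbase t) * tcomp t a m j).

Definition hlift (R : realType) (n : nat) (M : smooth_manifold R n)
    (g : riemannian_metric M) (a : atlas M) (X : M -> 'rV[R]_n) :
    tensor11 M -> ('rV[R]_n * 'M[R]_n)%type :=
  fun t => (X (tbase t), hlift_fibre g a t (X (tbase t))).

(* ^Sg_f: a tangent vector w at t splits into the horizontal lift of w.1 and
   the vertical vector w.2 - hlift_fibre g a t w.1. *)
Definition sasaki (R : realType) (n : nat) (M : smooth_manifold R n)
    (g : riemannian_metric M) (f : M -> R) (a : atlas M)
    (Y Z : tensor11 M -> ('rV[R]_n * 'M[R]_n)%type) : tensor11 M -> R :=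
  fun t =>
    let p := tbase t in
    let A := (Y t).2 - hlift_fibre g a t (Y t).1 in
    let B := (Z t).2 - hlift_fibre g a t (Z t).1 in
    f p * ((Y t).1 *m metric g a p *m ((Z t).1)^T) 0 0
    + \sum_(i < n) \sum_(c < n) \sum_(j < n) \sum_(l < n)
        metric g a p i c * inv_metric g a p j l * A i j * B c l.

Lemma hlift_fibre0 (R : realType) (n : nat) (M : smooth_manifold R n)
    (g : riemannian_metric M) (a : atlas M) (t : tensor11 M) :
  hlift_fibre g a t 0 = 0.
Proof.
by apply/matrixP => i j; rewrite !mxE big1 // => s _; rewrite mxE mul0r.
Qed.

Lemma sasakiVV (R : realType) (n : nat) (M : smooth_manifold R n)
    (g : riemannian_metric M) (f : M -> R) (a : atlas M)
    (A B : M -> 'M[R]_n) (t : tensor11 M) :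
  sasaki g f a (vlift A) (vlift B) t =
  \sum_(i < n) \sum_(c < n) \sum_(j < n) \sum_(l < n)
    metric g a (tbase t) i c * inv_metric g a (tbase t) j l *
    A (tbase t) i j * B (tbase t) c l.
Proof.
by rewrite /sasaki /= !hlift_fibre0 !subr0 !mul0mx mxE mulr0 add0r.
Qed.

Lemma sasakiVH (R : realType) (n : nat) (M : smooth_manifold R n)
    (g : riemannian_metric M) (f : M -> R) (a : atlas M)
    (A : M -> 'M[R]_n) (Y : M -> 'rV[R]_n) (t : tensor11 M) :
  sasaki g f a (vlift A) (hlift g a Y) t = 0.
Proof.
rewrite /sasaki /= !mul0mx mxE mulr0 add0r subrr.
by do 4![rewrite big1 // => ? _]; rewrite [X in _ * X]mxE mulr0.
Qed.

Lemma sasakiHH (R : realType) (n : nat) (M : smooth_manifold R n)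
    (g : riemannian_metric M) (f : M -> R) (a : atlas M)
    (X Y : M -> 'rV[R]_n) (t : tensor11 M) :
  sasaki g f a (hlift g a X) (hlift g a Y) t =
  f (tbase t) *
    (X (tbase t) *m metric g a (tbase t) *m (Y (tbase t))^T) 0 0.
Proof.
rewrite /sasaki /= !subrr [X in _ + X]big1 ?addr0 // => ? _.
by do 3![rewrite big1 // => ? _]; rewrite [X in _ * X]mxE mulr0.
Qed.

(** * Adapted frame and metric connection *)

Definition EH (R : realType) (n : nat) (M : smooth_manifold R n)
    (g : riemannian_metric M) (a : atlas M) (j : 'I_n) :
    tensor11 M -> ('rV[R]_n * 'M[R]_n)%type :=
  hlift g a (@coord_field R n M j).

(* EV i j = ^V(d_i (x) dx^j) *)
Definition EV (R : realType) (n : nat) (M : smooth_manifold R n)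
    (i j : 'I_n) : tensor11 M -> ('rV[R]_n * 'M[R]_n)%type :=
  @vlift R n M (fun=> delta_mx i j).

Definition frame (R : realType) (n : nat) (M : smooth_manifold R n)
    (g : riemannian_metric M) (a : atlas M) (al : 'I_n + 'I_n * 'I_n) :
    tensor11 M -> ('rV[R]_n * 'M[R]_n)%type :=
  match al with inl j => EH g a j | inr (i, j) => @EV R n M i j end.

Definition vertical_index (n : nat) (al : 'I_n + 'I_n * 'I_n) : bool :=
  if al is inr _ then true else false.

(* D is the metric connection, on the preimage of the domain of a *)
Record sasaki_metric_connection (R : realType) (n : nat)
    (M : smooth_manifold R n) (g : riemannian_metric M) (f : M -> R)
    (a : atlas M)
    (D : (tensor11 M -> ('rV[R]_n * 'M[R]_n)%type) ->
         (tensor11 M -> ('rV[R]_n * 'M[R]_n)%type) ->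
         (tensor11 M -> ('rV[R]_n * 'M[R]_n)%type)) : Prop := {
  smc_affine : affine_connection (tchart a) D;
  smc_metric : forall X Y Z,
    smooth_in (tchart a) X -> smooth_in (tchart a) Y ->
    smooth_in (tchart a) Z ->
    field_eq (tchart a)
      (der (tchart a) X (sasaki g f a Y Z))
      (fun t => sasaki g f a (D X Y) Z t + sasaki g f a Y (D X Z) t);
  smc_HH : forall l j, field_eq (tchart a) (D (EH g a l) (EH g a j))
    (fun t => \sum_(r < n)
      (christoffel g a l j r (tbase t)
       + (2 * f (tbase t))^-1 * fA g f a l j r (tbase t)) *: EH g a r t);
  smc_HV : forall l i j, field_eq (tchart a) (D (EH g a l) (@EV R n M i j))
    (fun t => \sum_(v < n) \sum_(r < n)
      (christoffel g a l i v (tbase t) * (r == j)%:R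
       - christoffel g a l r j (tbase t) * (v == i)%:R) *: @EV R n M v r t);
  smc_VH : forall c l j, field_eq (tchart a) (D (@EV R n M c l) (EH g a j))
    (fun=> 0);
  smc_VV : forall c l i j, field_eq (tchart a)
    (D (@EV R n M c l) (@EV R n M i j)) (fun=> 0) }.

(* Main.v *)
Require Import Defs.
From HB Require Import structures.
From mathcomp Require Import all_boot all_order all_algebra.
From mathcomp Require Import boolp classical_sets functions reals.
From mathcomp Require Import topology normedtype derive landau.
From mathcomp Require Import ring.

Set Implicit Arguments.
Unset Strict Implicit.
Unset Printing Implicit Defensive.

Import Order.TTheory GRing.Theory Num.Theory.
Import numFieldNormedType.Exports.

Local Open Scope ring_scope.
Local Open Scope classical_set_scope.

(** Let E_a be the adapted frame.  By hypothesis D_{E_a} E_b = C_ab^c E_c, where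
    the structure functions C_ab^c come from functions on M and vanish when E_a
    is vertical.  Three facts give the curvature.

    The bracket [E_a, E_b] is vertical ([frame_bracket]): in the induced chart
    every E_a is a constant vector plus a vertical one.  Vertical fields
    annihilate the frame under D, so the bracket term of the curvature
    disappears ([conn_bracket]), and the coefficients of the bracket never have
    to be computed; only their smoothness matters.

    A function of the base point is annihilated by vertical fields, and E_m acts
    on it as the coordinate field of index m ([der_frame_base]).  So the usual
    formula for the curvature in a frame ([curvature_frame]) reduces to an
    expression in C and its partial derivatives on M ([frame_curvature]).  It
    vanishes as soon as E_a or E_b is vertical, because every term contains a
    derivative along, or a coefficient of, a vertical field.

    For two horizontal fields what remains is algebra.  On horizontal fields
    C = Gamma + S with S = fA / (2 f); the products Gamma S, with the partial
    derivatives of S, form the covariant derivatives of S because Gamma is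
    symmetric ([curv_coef_HH]).  On vertical fields C is the action of Gamma on
    (1,1)-tensors, whose commutators are the action of the Riemann tensor
    ([curv_coef_HV]).

    The analytic part of the proof shows that these computations are licit: the
    charts of the bundle have open images, and everything that is differentiated
    or inserted in D is smooth.  Openness comes from the existence of a tensor
    with prescribed components in a chart ([tensor11_exists]), which rests on
    the cocycle identity of the Jacobian matrices ([jac_comp]); smoothness comes
    from closure properties of C^k functions, down to Cramer's rule for the
    inverse of the metric ([smooth_in_invmx]). *)

(** * Differentiability: locality and the product rule *)

Section Calculus.
Context {R : realType}.
Implicit Types V W : normedModType R.

(** Differentiability at a point only depends on the germ: both functions have
    the same first-order expansion there. *)
Lemma near_eq_differentiable V W (F G : V -> W) x :
  (\forall y \near x, F y = G y) -> differentiable F x -> differentiable G x.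
Proof.
move=> FG dF; have FGx : F x = G x by exact: (nbhs_singleton FG).
have cd := diff_continuous dF.
have E : G \o shift x = cst (G x) + 'd F x +o_ 0 id.
  apply/eqaddoP => e e0.
  have /diff_locallyP[_ /eqaddoP /(_ e e0) H] := dF.
  have FG0 : \forall y \near (0 : V), F (y + x) = G (y + x).
    move: FG; rewrite (near_shift 0 x); apply: filterS => y /=.
    by rewrite subr0.
  near=> y.
  have <- : (F \o shift x - (cst (F x) + 'd F x)) y =
      (G \o shift x - (cst (G x) + 'd F x)) y.
    rewrite !fctE /= FGx; congr (_ - _); have: F (y + x) = G (y + x) by near: y.
    by [].
  by near: y.
apply/diff_locallyP.
by rewrite (diff_unique cd E).
Unshelve. all: by end_near. Qed.

Lemma scale_is_bilinear W :
  bilinear_for (GRing.Scale.Law.clone _ _ *:%R _)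
    (GRing.Scale.Law.clone _ _ *:%R _) (@GRing.scale R W).
Proof.
split=> [w|c] a x y /=; first by rewrite scalerDl scalerA.
by rewrite scalerDr !scalerA mulrC.
Qed.

Lemma is_diff_scale V W (h : V -> R) (F : V -> W) x :
  differentiable h x -> differentiable F x ->
  is_diff x (fun y => h y *: F y)
    (fun v => 'd h x v *: F x + h x *: 'd F x v).
Proof.
move=> dh dF.
pose sM := bilinear_isBilinear.Build R R W W _ _ (@GRing.scale R W)
  (scale_is_bilinear W).
pose sL : {bilinear R -> W -> W} := HB.pack (@GRing.scale R W) sM.
have sc : continuous (fun p : R * W => sL p.1 p.2) by exact: scale_continuous.
have dsL q : differentiable (fun p : R * W => sL p.1 p.2) q.
  exact: differentiable_bilin.
have dhF := differentiable_pair dh dF.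
rewrite (_ : (fun y => h y *: F y) =
   (fun p : R * W => sL p.1 p.2) \o (fun y => (h y, F y))) //.
apply: DiffDef; first exact: differentiable_comp.
rewrite diff_comp // diff_bilin // diff_pair //.
by rewrite funeqE => v /=; rewrite addrC.
Qed.

End Calculus.

(** * Closure properties of C^k functions on an open set *)

Section Ck.
Context {R : realType}.
Implicit Types V W : normedModType R.

Lemma derive_scale V W (h : V -> R) (F : V -> W) x v :
  differentiable h x -> differentiable F x ->
  'D_v (fun y => h y *: F y) x = 'D_v h x *: F x + h x *: 'D_v F x.
Proof.
move=> dh dF; have dhF := is_diff_scale dh dF.
by rewrite !deriveE // diff_val.
Qed.

Lemma derive_postcomp_linear V W W' (L : {linear W -> W'}) (F : V -> W) x v :
  continuous L -> differentiable F x -> 'D_v (L \o F) x = L ('D_v F x).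
Proof.
move=> cL dF; have dL := linear_differentiable (F x) cL.
rewrite deriveE; last exact: differentiable_comp.
by rewrite diff_comp // diff_lin //= deriveE.
Qed.

Lemma derive_precomp_linear V V' W (L : {linear V' -> V}) (F : V -> W) x v :
  continuous L -> differentiable F (L x) ->
  'D_v (F \o L) x = 'D_(L v) F (L x).
Proof.
move=> cL dF; have dL := linear_differentiable x cL.
rewrite deriveE; last exact: differentiable_comp.
by rewrite diff_comp // [X in _ \o X]diff_lin //= deriveE.
Qed.

Lemma derive_inv V (h : V -> R) x v : differentiable h x -> h x != 0 ->
  'D_v (fun y => (h y)^-1) x = - ((h x)^-1 * (h x)^-1 * 'D_v h x).
Proof.
move=> dh hx; rewrite deriveE; last exact: differentiableV.
by rewrite diffV // deriveE //= expr2 invfM scaleNr.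
Qed.

(** Openness of U makes two functions that agree on U have the same derivatives
    on U.  The product and quotient rules below only hold on U, so this is what
    allows them to be used in inductions on the order. *)
Lemma Ck_on_eq V W k (U : set V) (F G : V -> W) :
  open U -> (forall x, U x -> F x = G x) -> Ck_on k U F -> Ck_on k U G.
Proof.
move=> Uo; elim: k F G => [|k IHk] F G FG /=.
  move=> cF x Ux; have FGx : \forall y \near x, F y = G y.
    by apply: filterS (open_nbhs_nbhs (conj Uo Ux)).
  have := cF x Ux; rewrite /prop_for /continuous_at FG //.
  by apply: cvg_trans; apply: near_eq_cvg.
have FGn x : U x -> \forall y \near x, F y = G y.
  by move=> Ux; apply: filterS (open_nbhs_nbhs (conj Uo Ux)).
case=> dF ckF; split=> [x Ux|v].
  by apply: near_eq_differentiable (FGn x Ux) (dF x Ux).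
by apply: IHk (ckF v) => x /FGn; apply: near_eq_derive.
Qed.

Lemma Ck_onW V W k (U : set V) (F : V -> W) : Ck_on k.+1 U F -> Ck_on k U F.
Proof.
elim: k F => [|k IHk] F /= [dF ckF].
  by move=> x Ux; apply/differentiable_continuous/dF.
by split=> // v; apply: IHk (ckF v).
Qed.

Lemma Ck_on_cst V W k (U : set V) (w : W) : Ck_on k U (fun=> w).
Proof.
elim: k w => [|k IHk] w /=; first by move=> x _; apply: cst_continuous.
split=> [x _|v]; first exact: differentiable_cst.
have -> : (fun x => 'D_v (fun=> w) x) = (fun=> 0) :> (V -> W); last exact: IHk.
by apply/funext => x; apply: derive_cst.
Qed.

Lemma Ck_on_add V W k (U : set V) (F G : V -> W) : open U ->
  Ck_on k U F -> Ck_on k U G -> Ck_on k U (fun x => F x + G x).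
Proof.
move=> Uo; elim: k F G => [|k IHk] F G /=.
  by move=> cF cG x Ux; apply: continuousD; [apply: cF|apply: cG].
move=> [dF cF] [dG cG]; split=> [x Ux|v].
  by apply: differentiableD; [apply: dF|apply: dG].
apply: Ck_on_eq (IHk _ _ (cF v) (cG v)) => // x Ux.
by rewrite -deriveD //; apply/diff_derivable; [apply: dF|apply: dG].
Qed.

(** By the product rule, the derivative of h F is a sum of products of one
    order of smoothness less, to which the induction applies. *)
Lemma Ck_on_scale V W k (U : set V) (h : V -> R) (F : V -> W) : open U ->
  Ck_on k U h -> Ck_on k U F -> Ck_on k U (fun x => h x *: F x).
Proof.
move=> Uo; elim: k h F => [|k IHk] h F ch cF.
  by move=> x Ux; apply: continuousZ; [apply: ch|apply: cF].
have ch' := Ck_onW ch; have cF' := Ck_onW cF.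
case: ch cF => [dh ch] [dF cF]; split=> [x Ux|v].
  by have [] := is_diff_scale (dh x Ux) (dF x Ux).
apply: Ck_on_eq (Ck_on_add Uo (IHk _ _ (ch v) cF') (IHk _ _ ch' (cF v))) => //.
by move=> x Ux; rewrite -derive_scale //; [apply: dh|apply: dF].
Qed.

(** The derivative of 1 / h is - (1 / h)^2 dh, which involves 1 / h at the
    order already dealt with. *)
Lemma Ck_on_inv V k (U : set V) (h : V -> R) : open U ->
  (forall x, U x -> h x != 0) -> Ck_on k U h -> Ck_on k U (fun x => (h x)^-1).
Proof.
move=> Uo h0; elim: k => [|k IHk] ch.
  by move=> x Ux; apply: continuousV; [apply: h0|apply: ch].
have ck := IHk (Ck_onW ch).
case: ch => dh ch; split=> [x Ux|v].
  by apply: differentiableV; [apply: dh|apply: h0].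
have c1 := Ck_on_scale Uo (Ck_on_scale Uo ck ck) (ch v).
have c2 := Ck_on_scale Uo (@Ck_on_cst V R k U (-1)) c1.
apply: Ck_on_eq c2 => // x Ux.
by rewrite (derive_inv _ (dh x Ux) (h0 x Ux)) scaleN1r.
Qed.

Lemma Ck_on_postcomp_linear V W W' k (U : set V) (L : {linear W -> W'})
    (F : V -> W) :
  open U -> continuous L -> Ck_on k U F -> Ck_on k U (L \o F).
Proof.
move=> Uo cL; elim: k F => [|k IHk] F.
  by move=> cF x Ux; apply: continuous_comp; [apply: cF|apply: cL].
case=> dF cF; split=> [x Ux|v].
  by apply: differentiable_comp; [apply: dF|apply: linear_differentiable].
apply: Ck_on_eq (IHk _ (cF v)) => // x Ux.
by rewrite derive_postcomp_linear //; apply: dF.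
Qed.

Lemma Ck_on_precomp_linear V V' W k (U : set V) (U' : set V')
    (L : {linear V' -> V}) (F : V -> W) : open U' ->
  (forall x, U' x -> U (L x)) -> continuous L -> Ck_on k U F ->
  Ck_on k U' (F \o L).
Proof.
move=> Uo LU cL; elim: k F => [|k IHk] F.
  by move=> cF x Ux; apply: continuous_comp; [apply: cL|apply/cF/LU].
case=> dF cF; split=> [x Ux|v].
  by apply: differentiable_comp; [apply: linear_differentiable|apply/dF/LU].
apply: Ck_on_eq (IHk _ (cF (L v))) => // x Ux.
by rewrite derive_precomp_linear //; apply/dF/LU.
Qed.

Lemma Ck_on_linear V W k (U : set V) (L : {linear V -> W}) :
  continuous L -> Ck_on k U L.
Proof.
move=> cL; case: k => [|k] /=; first by move=> x _; apply: cL.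
split=> [x Ux|v]; first exact: linear_differentiable.
have -> : (fun x => 'D_v L x) = (fun=> L v) :> (V -> W); last exact: Ck_on_cst.
by apply/funext => x; rewrite deriveE ?diff_lin //;
  apply: linear_differentiable.
Qed.

End Ck.

(** * Smooth functions and derivatives in one chart *)

Section ChartCalculus.
Context {R : realType} {N : Type} {E : normedModType R}.
Variable c : local_chart N E.
Implicit Types (V W : normedModType R).

(** What the calculus needs from a chart: injectivity makes the local
    expression of h agree with h, and openness of the image makes its
    derivatives depend on h on the domain alone. *)
Definition regular_chart : Prop :=
  open (chart_map c @` chart_dom c) /\
  (forall p q, chart_dom c p -> chart_dom c q ->
     chart_map c p = chart_map c q -> p = q).

Lemma local_expr_eq W (h h' : N -> W) :
  field_eq c h h' -> local_expr c h = local_expr c h'.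
Proof.
move=> hh'; apply/funext => x; rewrite /local_expr; congr (xget _ _).
by apply/seteqP; split=> w /= [p dp [cp ->]]; exists p; rewrite // hh'.
Qed.

Lemma smooth_in_eq W (h h' : N -> W) :
  field_eq c h h' -> smooth_in c h -> smooth_in c h'.
Proof. by rewrite /smooth_in => /local_expr_eq ->. Qed.

Lemma der_eq W (X X' : N -> E) (h h' : N -> W) p : X p = X' p ->
  field_eq c h h' -> der c X h p = der c X' h' p.
Proof. by rewrite /der => -> /local_expr_eq ->. Qed.

Hypothesis rc : regular_chart.

Lemma local_exprE W (h : N -> W) p :
  chart_dom c p -> local_expr c h (chart_map c p) = h p.
Proof.
move=> dp; apply: xget_unique; first by exists p.
by move=> w [q dq [/(rc.2 _ _ dq dp) -> ->]].
Qed.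

Lemma smooth_in_ext W (F : E -> W) (h : N -> W) :
  (forall p, chart_dom c p -> F (chart_map c p) = h p) ->
  smooth_on (chart_map c @` chart_dom c) F -> smooth_in c h.
Proof.
move=> Fh sF k; apply: Ck_on_eq (sF k); first exact: rc.1.
by move=> _ [p dp <-]; rewrite Fh // local_exprE.
Qed.

Lemma der_ext W (F : E -> W) (X : N -> E) (h : N -> W) p :
  (forall q, chart_dom c q -> F (chart_map c q) = h q) -> chart_dom c p ->
  der c X h p = 'D_(X p) F (chart_map c p).
Proof.
move=> Fh dp; apply: near_eq_derive.
have Up : (chart_map c @` chart_dom c) (chart_map c p) by exists p.
apply: filterS (open_nbhs_nbhs (conj rc.1 Up)) => _ [q dq <-].
by rewrite Fh // local_exprE.
Qed.

Lemma smooth_in_diff W (h : N -> W) p : smooth_in c h -> chart_dom c p ->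
  differentiable (local_expr c h) (chart_map c p).
Proof. by move=> /(_ 1%N) [+ _] dp; apply; exists p. Qed.

Lemma smooth_in_cst W (w : W) : smooth_in c (fun=> w).
Proof. by apply: (@smooth_in_ext _ (fun=> w)) => // k; apply: Ck_on_cst. Qed.

Lemma smooth_in_add W (F G : N -> W) :
  smooth_in c F -> smooth_in c G -> smooth_in c (fun p => F p + G p).
Proof.
move=> sF sG.
apply: (@smooth_in_ext _ (fun x => local_expr c F x + local_expr c G x)).
  by move=> p dp; rewrite !local_exprE.
by move=> k; apply: Ck_on_add; [exact: rc.1|apply: sF|apply: sG].
Qed.

Lemma smooth_in_scale W (h : N -> R) (F : N -> W) :
  smooth_in c h -> smooth_in c F -> smooth_in c (fun p => h p *: F p).
Proof.
move=> sh sF.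
apply: (@smooth_in_ext _ (fun x => local_expr c h x *: local_expr c F x)).
  by move=> p dp; rewrite !local_exprE.
by move=> k; apply: Ck_on_scale; [exact: rc.1|apply: sh|apply: sF].
Qed.

Lemma smooth_in_mul (h k : N -> R) :
  smooth_in c h -> smooth_in c k -> smooth_in c (fun p => h p * k p).
Proof. exact: smooth_in_scale. Qed.

Lemma smooth_in_opp W (F : N -> W) :
  smooth_in c F -> smooth_in c (fun p => - F p).
Proof.
move=> sF; apply: smooth_in_eq (smooth_in_scale (@smooth_in_cst R (-1)) sF).
by move=> p _; rewrite scaleN1r.
Qed.

Lemma smooth_in_sub W (F G : N -> W) :
  smooth_in c F -> smooth_in c G -> smooth_in c (fun p => F p - G p).
Proof. by move=> sF sG; apply/smooth_in_add/smooth_in_opp. Qed.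

Lemma smooth_in_inv (h : N -> R) : (forall p, chart_dom c p -> h p != 0) ->
  smooth_in c h -> smooth_in c (fun p => (h p)^-1).
Proof.
move=> h0 sh; apply: (@smooth_in_ext _ (fun x => (local_expr c h x)^-1)).
  by move=> p dp; rewrite local_exprE.
move=> k; apply: Ck_on_inv; [exact: rc.1| |exact: sh].
by move=> _ [p dp <-]; rewrite local_exprE // h0.
Qed.

Lemma smooth_in_sum W I (r : seq I) (P : pred I) (F : I -> N -> W) :
  (forall i, P i -> smooth_in c (F i)) ->
  smooth_in c (fun p => \sum_(i <- r | P i) F i p).
Proof.
move=> sF; elim: r => [|i r IHr].
  by apply: smooth_in_eq (@smooth_in_cst W 0) => p _; rewrite big_nil.
case Pi: (P i); last by apply: smooth_in_eq IHr => p _; rewrite big_cons Pi.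
apply: smooth_in_eq (smooth_in_add (sF i Pi) IHr) => p _.
by rewrite big_cons Pi.
Qed.

Lemma smooth_in_prod I (r : seq I) (P : pred I) (h : I -> N -> R) :
  (forall i, P i -> smooth_in c (h i)) ->
  smooth_in c (fun p => \prod_(i <- r | P i) h i p).
Proof.
move=> sF; elim: r => [|i r IHr].
  by apply: smooth_in_eq (@smooth_in_cst R 1) => p _; rewrite big_nil.
case Pi: (P i); last by apply: smooth_in_eq IHr => p _; rewrite big_cons Pi.
apply: smooth_in_eq (smooth_in_mul (sF i Pi) IHr) => p _.
by rewrite big_cons Pi.
Qed.

Lemma smooth_in_linear W W' (L : {linear W -> W'}) (F : N -> W) :
  continuous L -> smooth_in c F -> smooth_in c (fun p => L (F p)).
Proof.
move=> cL sF; apply: (@smooth_in_ext _ (L \o local_expr c F)).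
  by move=> p dp /=; rewrite local_exprE.
by move=> k; apply: Ck_on_postcomp_linear; [exact: rc.1|exact: cL|apply: sF].
Qed.

Lemma der_cst W X (w : W) p : chart_dom c p -> der c X (fun=> w) p = 0.
Proof. by move=> dp; rewrite (@der_ext _ (fun=> w)) // derive_cst. Qed.

Lemma derD W X (F G : N -> W) p : chart_dom c p ->
  smooth_in c F -> smooth_in c G ->
  der c X (fun q => F q + G q) p = der c X F p + der c X G p.
Proof.
move=> dp sF sG.
rewrite (@der_ext _ (fun x => local_expr c F x + local_expr c G x)) //.
  by rewrite deriveD //; apply/diff_derivable/smooth_in_diff.
by move=> q dq; rewrite !local_exprE.
Qed.

Lemma derZ W X (h : N -> R) (F : N -> W) p : chart_dom c p ->
  smooth_in c h -> smooth_in c F ->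
  der c X (fun q => h q *: F q) p = der c X h p *: F p + h p *: der c X F p.
Proof.
move=> dp sh sF.
rewrite (@der_ext _ (fun x => local_expr c h x *: local_expr c F x)) //.
  rewrite derive_scale; [|exact: smooth_in_diff..].
  by rewrite !local_exprE.
by move=> q dq; rewrite !local_exprE.
Qed.

Lemma der_linear W W' X (L : {linear W -> W'}) (F : N -> W) p :
  continuous L -> chart_dom c p -> smooth_in c F ->
  der c X (fun q => L (F q)) p = L (der c X F p).
Proof.
move=> cL dp sF; rewrite (@der_ext _ (L \o local_expr c F)) //.
  by rewrite derive_postcomp_linear //; apply: smooth_in_diff.
by move=> q dq /=; rewrite local_exprE.
Qed.

Lemma der_sum W X I (r : seq I) (F : I -> N -> W) p : chart_dom c p ->
  (forall i, smooth_in c (F i)) ->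
  der c X (fun q => \sum_(i <- r) F i q) p = \sum_(i <- r) der c X (F i) p.
Proof.
move=> dp sF; elim: r => [|i r IHr].
  rewrite big_nil; apply: etrans (der_cst X (0 : W) dp).
  by apply: der_eq => // q _; rewrite big_nil.
rewrite big_cons -IHr -derD //; last exact: smooth_in_sum.
by apply: der_eq => // q _; rewrite big_cons.
Qed.

(** A derivative is linear in the direction; isolating the constant vector v0
    fits horizontal lifts, whose base component is constant in the chart. *)
Lemma der_combination W (X : N -> E) I (r : seq I) (k : I -> R)
    (v0 : E) (v : I -> E) (h : N -> W) p :
  chart_dom c p -> smooth_in c h -> X p = v0 + \sum_(i <- r) k i *: v i ->
  der c X h p =
  der c (fun=> v0) h p + \sum_(i <- r) k i *: der c (fun=> v i) h p.
Proof.
move=> dp sh; rewrite /der => ->.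
have dh := smooth_in_diff sh dp.
rewrite !deriveE // linearD linear_sum; congr (_ + _).
by apply: eq_bigr => i _; rewrite deriveE // linearZ.
Qed.

Lemma smooth_in_der_cst W (v : E) (h : N -> W) :
  smooth_in c h -> smooth_in c (der c (fun=> v) h).
Proof.
move=> sh; apply: (@smooth_in_ext _ ('D_v (local_expr c h))) => // k.
by have [_] := sh k.+1; apply.
Qed.

Lemma smooth_in_der W (X : N -> E) I (r : seq I) (k : I -> N -> R)
    (v0 : E) (v : I -> E) (h : N -> W) :
  (forall i, smooth_in c (k i)) ->
  (forall p, X p = v0 + \sum_(i <- r) k i p *: v i) -> smooth_in c h ->
  smooth_in c (der c X h).
Proof.
move=> sk EX sh.
apply: (@smooth_in_eq _ (fun p => der c (fun=> v0) h p +
   \sum_(i <- r) k i p *: der c (fun=> v i) h p)).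
  by move=> p dp; rewrite (der_combination dp sh (EX p)).
apply: smooth_in_add; first exact: smooth_in_der_cst.
by apply: smooth_in_sum => i _; apply: smooth_in_scale => //;
   apply: smooth_in_der_cst.
Qed.

End ChartCalculus.

(** * Affine connections and curvature in a frame *)

Section Connection.
Context {R : realType} {N : Type} {E : normedModType R}.
Variables (c : local_chart N E) (D : (N -> E) -> (N -> E) -> (N -> E)).
Hypotheses (rc : regular_chart c) (aD : affine_connection c D).

(** Fields are functions on the whole of N with arbitrary values outside of the
    domain, so a connection is not obviously local to the domain.  The function
    that is 0 on the domain and 1 elsewhere counts as smooth, and multiplying
    by it does not change a field that vanishes on the domain; linearity over
    such functions then forces the value 0. *)
Lemma vanishing_field_cutoff (Z : N -> E) : field_eq c Z (fun=> 0) ->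
  exists2 h : N -> R, field_eq c (fun=> 0) h & (fun q => h q *: Z q) = Z.
Proof.
move=> Z0; exists (fun q => if `[< chart_dom c q >] then 0 else 1).
  by move=> q dq; rewrite asboolT.
apply/funext => q; case: asboolP => dq; last by rewrite scale1r.
by rewrite scale0r Z0.
Qed.

Lemma conn_zerol Z Y p : smooth_in c Z -> smooth_in c Y -> chart_dom c p ->
  field_eq c Z (fun=> 0) -> D Z Y p = 0.
Proof.
move=> sZ sY dp /vanishing_field_cutoff[h h0 hZ].
have sh := smooth_in_eq h0 (smooth_in_cst rc (0 : R)).
by have := conn_scalel aD sh sZ sY dp; rewrite hZ -h0 // scale0r.
Qed.

Lemma conn_zeror X Z p : smooth_in c X -> smooth_in c Z -> chart_dom c p ->
  field_eq c Z (fun=> 0) -> D X Z p = 0.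
Proof.
move=> sX sZ dp /vanishing_field_cutoff[h h0 hZ].
have sh := smooth_in_eq h0 (smooth_in_cst rc (0 : R)).
have := conn_leibniz aD sh sX sZ dp; rewrite hZ -h0 // scale0r addr0.
by rewrite -(der_eq erefl h0) der_cst // scale0r.
Qed.

Lemma conn_eql X X' Y p : smooth_in c X -> smooth_in c Y -> chart_dom c p ->
  field_eq c X X' -> D X Y p = D X' Y p.
Proof.
move=> sX sY dp XX'; have sX' := smooth_in_eq XX' sX.
have sB := smooth_in_sub rc sX' sX.
have := conn_addl aD sX sB sY dp.
rewrite (conn_zerol sB sY dp) ?addr0 => [<-|q dq]; last by rewrite XX' // subrr.
by congr (D _ Y p); apply/funext => q; rewrite addrC subrK.
Qed.

Lemma conn_eqr X Y Y' p : smooth_in c X -> smooth_in c Y -> chart_dom c p ->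
  field_eq c Y Y' -> D X Y p = D X Y' p.
Proof.
move=> sX sY dp YY'; have sY' := smooth_in_eq YY' sY.
have sB := smooth_in_sub rc sY' sY.
have := conn_addr aD sX sY sB dp.
rewrite (conn_zeror sX sB dp) ?addr0 => [<-|q dq]; last by rewrite YY' // subrr.
by congr (D X _ p); apply/funext => q; rewrite addrC subrK.
Qed.

Lemma conn_combinationl I (r : seq I) (k : I -> N -> R) (e : I -> N -> E) Y p :
  (forall i, smooth_in c (k i)) -> (forall i, smooth_in c (e i)) ->
  smooth_in c Y -> chart_dom c p ->
  D (fun q => \sum_(i <- r) k i q *: e i q) Y p =
  \sum_(i <- r) k i p *: D (e i) Y p.
Proof.
move=> sk se sY dp.
have ske i : smooth_in c (fun q => k i q *: e i q) by apply: smooth_in_scale.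
elim: r => [|i r IHr].
  rewrite big_nil; apply: conn_zerol => //; first exact: smooth_in_sum.
  by move=> q _; rewrite big_nil.
rewrite big_cons -IHr -(conn_scalel aD) //.
rewrite -(conn_addl aD) //; last exact: smooth_in_sum.
by congr (D _ Y p); apply/funext => q; rewrite big_cons.
Qed.

Lemma conn_combinationr I (r : seq I) (k : I -> N -> R) (e : I -> N -> E) X p :
  (forall i, smooth_in c (k i)) -> (forall i, smooth_in c (e i)) ->
  smooth_in c X -> chart_dom c p ->
  D X (fun q => \sum_(i <- r) k i q *: e i q) p =
  \sum_(i <- r) (der c X (k i) p *: e i p + k i p *: D X (e i) p).
Proof.
move=> sk se sX dp.
have ske i : smooth_in c (fun q => k i q *: e i q) by apply: smooth_in_scale.
elim: r => [|i r IHr].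
  rewrite big_nil; apply: conn_zeror => //; first exact: smooth_in_sum.
  by move=> q _; rewrite big_nil.
rewrite big_cons -IHr -(conn_leibniz aD) //.
rewrite -(conn_addr aD) //; last exact: smooth_in_sum.
by congr (D X _ p); apply/funext => q; rewrite big_cons.
Qed.

Section Frame.
Variables (I : finType) (e : I -> N -> E) (C : I -> I -> I -> N -> R).
Hypotheses (se : forall i, smooth_in c (e i))
  (sC : forall i j k, smooth_in c (C i j k))
  (De : forall i j,
     field_eq c (D (e i) (e j)) (fun p => \sum_k C i j k p *: e k p)).

Lemma iterated_conn_frame i j k p : chart_dom c p ->
  D (e i) (D (e j) (e k)) p =
  \sum_l (der c (e i) (C j k l) p + \sum_s C j k s p * C i s l p) *: e l p.
Proof.
move=> dp; rewrite (conn_eqr (se i) _ dp (De j k)); last exact: conn_smooth.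
rewrite conn_combinationr // big_split /=.
under [X in _ + X]eq_bigr => s _ do rewrite De // scaler_sumr.
rewrite exchange_big -big_split /=; apply: eq_bigr => l _.
rewrite scalerDl scaler_suml; congr (_ + _).
by apply: eq_bigr => s _; rewrite scalerA.
Qed.

(** The structure functions C of a connection in a frame determine its
    curvature up to the bracket term: second derivatives expand by the Leibniz
    rule.  The frame need not be holonomic. *)
Lemma curvature_frame i j k p : chart_dom c p ->
  curvature c D (e i) (e j) (e k) p =
  \sum_l (der c (e i) (C j k l) p - der c (e j) (C i k l) p
          + \sum_s C j k s p * C i s l p
          - \sum_s C i k s p * C j s l p) *: e l p
  - D (lie_bracket c (e i) (e j)) (e k) p.
Proof.
move=> dp; rewrite /curvature !iterated_conn_frame // -sumrB; congr (_ - _).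
apply: eq_bigr => l _; rewrite -scalerBl; congr (_ *: _).
by rewrite opprD addrACA addrA.
Qed.

End Frame.
End Connection.

(** * Jacobian cocycle and induced charts of the (1,1)-tensor bundle *)

Lemma fst_is_linear (R : realType) (V W : normedModType R) :
  linear (fst : V * W -> V).
Proof. by []. Qed.

HB.instance Definition _ (R : realType) (V W : normedModType R) :=
  GRing.isLinear.Build R (V * W)%type V _ fst (@fst_is_linear R V W).

Lemma snd_is_linear (R : realType) (V W : normedModType R) :
  linear (snd : V * W -> W).
Proof. by []. Qed.

HB.instance Definition _ (R : realType) (V W : normedModType R) :=
  GRing.isLinear.Build R (V * W)%type W _ snd (@snd_is_linear R V W).

Definition mx_entry (R : realType) m n (i : 'I_m) (j : 'I_n)
    (A : 'M[R]_(m, n)) : R := A i j.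

Lemma mx_entry_is_linear (R : realType) m n (i : 'I_m) (j : 'I_n) :
  linear (@mx_entry R m n i j).
Proof. by move=> k A B; rewrite /mx_entry !mxE. Qed.

HB.instance Definition _ (R : realType) m n (i : 'I_m) (j : 'I_n) :=
  GRing.isLinear.Build R 'M[R]_(m, n) R _ (@mx_entry R m n i j)
    (@mx_entry_is_linear R m n i j).

Lemma mx_entry_continuous (R : realType) m n (i : 'I_m) (j : 'I_n) :
  continuous (@mx_entry R m n i j).
Proof. exact: coord_continuous. Qed.

Section Jacobian.
Context {R : realType} {n : nat} (M : smooth_manifold R n).
Implicit Types (a b c : atlas M) (p : M).

Lemma manifold_chart_regular a : regular_chart (chart a).
Proof.
split; last exact: chart_inj.
by apply: chart_open_map => //; apply: chart_open.
Qed.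

Lemma transition_diff a b p : chart_dom (chart a) p -> chart_dom (chart b) p ->
  differentiable (local_expr (chart a) (chart_map (chart b)))
    (chart_map (chart a) p).
Proof. by move=> ap bp; apply: (chart_transition a b 1%N).1; exists p. Qed.

Lemma jac_deriv a b p v : chart_dom (chart a) p -> chart_dom (chart b) p ->
  v *m jac a b p =
  'D_v (local_expr (chart a) (chart_map (chart b))) (chart_map (chart a) p).
Proof.
by move=> ap bp; rewrite deriveEjacobian //; apply: transition_diff.
Qed.

Lemma eq_mulr_mx (A B : 'M[R]_n) :
  (forall v : 'rV[R]_n, v *m A = v *m B) -> A = B.
Proof. by move=> AB; apply/row_matrixP => i; rewrite !rowE. Qed.

Lemma jac_id a p : chart_dom (chart a) p -> jac a a p = 1%:M.
Proof.
move=> ap; apply: eq_mulr_mx => v; rewrite jac_deriv // mulmx1.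
have := der_ext (c := chart a) (F := id) (h := chart_map (chart a))
  (manifold_chart_regular a) (fun=> v) (fun _ _ => erefl) ap.
by rewrite /der derive_id.
Qed.

(** The chain rule, applied on the open image of the triple overlap. *)
Lemma jac_comp a b c p : chart_dom (chart a) p -> chart_dom (chart b) p ->
  chart_dom (chart c) p -> jac a b p *m jac b c p = jac a c p.
Proof.
move=> ap bp cp; apply: eq_mulr_mx => v.
have Dab := jac_deriv v ap bp; have Dbc := jac_deriv (v *m jac a b p) bp cp.
have Dac := jac_deriv v ap cp; rewrite Dab in Dbc.
apply: etrans (mulmxA _ _ _) _; apply: etrans (esym Dac).
apply: etrans (congr1 (mulmx^~ _) Dab) _; apply: etrans Dbc _.
set F := local_expr (chart a) (chart_map (chart b)).
set G := local_expr (chart b) (chart_map (chart c)).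
have Fa q : chart_dom (chart a) q ->
    F (chart_map (chart a) q) = chart_map (chart b) q.
  by apply: local_exprE; apply: manifold_chart_regular.
have dF : differentiable F (chart_map (chart a) p) by apply: transition_diff.
have dG : differentiable G (F (chart_map (chart a) p)).
  by rewrite Fa //; apply: transition_diff.
transitivity ('D_v (G \o F) (chart_map (chart a) p)).
  rewrite -(Fa p ap) (deriveE _ dG) (deriveE _ dF).
  apply: etrans (esym (deriveE v (differentiable_comp dF dG))).
  exact: esym (congr1 (fun L : 'rV[R]_n -> 'rV[R]_n => L v) (diff_comp dF dG)).
apply: near_eq_derive.
pose U := chart_dom (chart a) `&` (chart_dom (chart b) `&` chart_dom (chart c)).
have oU : open (chart_map (chart a) @` U).
  apply: chart_open_map; last by move=> q [].
  by do !apply: openI; apply: chart_open.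
have Up : (chart_map (chart a) @` U) (chart_map (chart a) p) by exists p.
apply: filterS (open_nbhs_nbhs (conj oU Up)) => _ [q [aq [bq cq]] <-] /=.
rewrite Fa // /G (local_exprE (manifold_chart_regular a)) //.
by rewrite (local_exprE (manifold_chart_regular b)).
Qed.

End Jacobian.

Section TensorChart.
Context {R : realType} {n : nat} (M : smooth_manifold R n).
Implicit Types (a b : atlas M) (p : M).

Lemma tensor11_ext (t u : tensor11 M) :
  tbase t = tbase u -> tcomp t = tcomp u -> t = u.
Proof.
case: t u => [p T lT oT] [q S lS oS] /= pq TS; subst q S.
by congr Tensor11; apply: Prop_irrelevance.
Qed.

(** Tensor components transform functorially: changing twice is changing
    along the composite.  Stated for arbitrary matrices, so that the cocycle
    identities enter as hypotheses. *)
Lemma mx_change_comp (A B A' B' J J' T : 'M[R]_n) :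
  A *m B = J -> B' *m A' = J' ->
  J^T *m T *m J'^T = B^T *m (A^T *m T *m A'^T) *m B'^T.
Proof. by move=> <- <-; rewrite !trmx_mul !mulmxA. Qed.

(** Every matrix is the matrix of components of some tensor at p: transport it
    to the other charts by the transformation law, which is consistent by the
    cocycle identity.  This makes the image of an induced chart a full cylinder,
    hence open. *)
Lemma tensor11_exists a p (T : 'M[R]_n) : chart_dom (chart a) p ->
  exists2 t : tensor11 M, tbase t = p & tcomp t a = T.
Proof.
move=> ap; pose S b : 'M[R]_n := if `[< chart_dom (chart b) p >] then
  (jac a b p)^T *m T *m (jac b a p)^T else 0.
have lS b c : chart_dom (chart b) p -> chart_dom (chart c) p ->
    S c = (jac b c p)^T *m S b *m (jac c b p)^T.
  move=> bp cp; rewrite /S (asboolT bp) (asboolT cp).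
  exact: mx_change_comp (jac_comp ap bp cp) (jac_comp cp bp ap).
have oS b : ~ chart_dom (chart b) p -> S b = 0 by move=> bp; rewrite /S asboolF.
exists (Tensor11 lS oS) => //=.
by rewrite /S (asboolT ap) (jac_id ap) trmx1 mul1mx mulmx1.
Qed.

Lemma tchart_image a : chart_map (tchart a) @` chart_dom (tchart a) =
  fst @^-1` (chart_map (chart a) @` chart_dom (chart a)).
Proof.
apply/seteqP; split=> [_ [t at_ <-]|[x T] [p ap /= px]].
  by exists (tbase t).
have [t tp tT] := tensor11_exists T ap.
by exists t; rewrite /= tp // tT px.
Qed.

(** Injectivity holds because the components in one chart around the base point
    determine those in every other chart, and the remaining ones are 0. *)
Lemma tchart_regular a : regular_chart (tchart a).
Proof.
split.
  rewrite tchart_image; apply: open_comp; first by move=> x _; apply: cvg_fst.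
  exact: (manifold_chart_regular a).1.
move=> t u at_ au [/(chart_inj at_ au) tu tuT]; apply: tensor11_ext => //.
apply/funext => b; have [bt|bt] := pselect (chart_dom (chart b) (tbase t)).
  have bu : chart_dom (chart b) (tbase u) by rewrite -tu.
  by rewrite (tcomp_law at_ bt) (tcomp_law au bu) tuT tu.
by rewrite !tcomp_out // -tu.
Qed.

Lemma smooth_in_pullback (W : normedModType R) a (h : M -> W) :
  smooth_in (chart a) h -> smooth_in (tchart a) (fun t => h (tbase t)).
Proof.
move=> sh; apply: (smooth_in_ext (tchart_regular a)
  (F := local_expr (chart a) h \o fst)).
  by move=> t at_ /=; rewrite (local_exprE (manifold_chart_regular a)).
move=> k; apply: Ck_on_precomp_linear (sh k).
- exact: (tchart_regular a).1.
- by move=> _ [t at_ <-]; exists (tbase t).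
- by move=> x; apply: cvg_fst.
Qed.

(** Functions of the base point only see the base component of a vector; in
    particular vertical vectors annihilate them. *)
Lemma der_pullback (W : normedModType R) a Y (h : M -> W) t :
  chart_dom (tchart a) t -> smooth_in (chart a) h ->
  der (tchart a) Y (fun u => h (tbase u)) t =
  der (chart a) (fun=> (Y t).1) h (tbase t).
Proof.
move=> at_ sh.
have hE u : chart_dom (tchart a) u ->
    (local_expr (chart a) h \o fst) (chart_map (tchart a) u) = h (tbase u).
  by move=> au /=; rewrite (local_exprE (manifold_chart_regular a)).
apply: etrans (der_ext (tchart_regular a) _ hE at_) _.
apply: derive_precomp_linear; first by move=> x; apply: cvg_fst.
by apply: smooth_in_diff => //; apply: manifold_chart_regular.
Qed.

Lemma smooth_in_tcomp a i j :
  smooth_in (tchart a) (fun t => tcomp t a i j).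
Proof.
apply: (smooth_in_ext (tchart_regular a)
  (F := mx_entry i j \o snd)) => // k.
apply: (Ck_on_precomp_linear (U := setT)) => //.
- exact: (tchart_regular a).1.
- by move=> x; apply: cvg_snd.
- by apply: Ck_on_linear; apply: mx_entry_continuous.
Qed.

End TensorChart.

(** * Christoffel symbols and the Riemann tensor *)

Section SmoothMatrix.
Context {R : realType} {N : Type} {E : normedModType R}.
Variable c : local_chart N E.
Hypothesis rc : regular_chart c.

Lemma smooth_in_det m (A : N -> 'M[R]_m) :
  (forall i j, smooth_in c (fun p => A p i j)) ->
  smooth_in c (fun p => \det (A p)).
Proof.
move=> sA; apply: smooth_in_sum => // s _.
by apply: smooth_in_mul => //; [apply: smooth_in_cst|apply: smooth_in_prod].
Qed.

(** Cramer's rule: the entries of the inverse are rational functions of the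
    entries, with the determinant as denominator. *)
Lemma smooth_in_invmx m (A : N -> 'M[R]_m) i j :
  (forall p, chart_dom c p -> A p \in unitmx) ->
  (forall i j, smooth_in c (fun p => A p i j)) ->
  smooth_in c (fun p => invmx (A p) i j).
Proof.
move=> uA sA.
have sV : smooth_in c (fun p => (\det (A p))^-1 *
    ((-1) ^+ (j + i) * \det (row' j (col' i (A p))))).
  apply: smooth_in_mul => //.
    apply: smooth_in_inv => //; last exact: smooth_in_det.
    by move=> p /uA; rewrite unitmxE unitfE.
  apply: smooth_in_mul => //; first exact: smooth_in_cst.
  apply: smooth_in_det => k l.
  by apply: smooth_in_eq (sA (lift j k) (lift i l)) => p _; rewrite !mxE.
by apply: smooth_in_eq sV => p dp; rewrite /invmx uA // !mxE.
Qed.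

Lemma smooth_in_row m (y : 'I_m -> N -> R) :
  (forall h, smooth_in c (y h)) -> smooth_in c (fun p => \row_h y h p).
Proof.
move=> sy.
have sS : smooth_in c (fun p => \sum_h y h p *: (delta_mx 0 h : 'rV[R]_m)).
  by apply: smooth_in_sum => // h _; apply: smooth_in_scale => //;
     apply: smooth_in_cst.
apply: smooth_in_eq sS => p _; rewrite [RHS]row_sum_delta.
by apply: eq_bigr => h _; rewrite mxE.
Qed.

End SmoothMatrix.

Section Coefficients.
Context {R : realType} {n : nat} (M : smooth_manifold R n).
Variables (g : riemannian_metric M) (f : M -> R) (a : atlas M).

Let rc := manifold_chart_regular a.

(** A vector in the kernel would have length 0. *)
Lemma metric_unitmx p : chart_dom (chart a) p -> metric g a p \in unitmx.
Proof.
move=> ap; rewrite -row_free_unit -kermx_eq0; apply/eqP/row_matrixP => i.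
rewrite row0; apply/eqP/negPn/negP => v0.
have := metric_pos g ap v0.
by rewrite -row_mul mulmx_ker row0 mul0mx mxE ltxx.
Qed.

Lemma metric_entry_smooth i j :
  smooth_in (chart a) (fun p => metric g a p i j).
Proof.
exact: (smooth_in_linear rc (@mx_entry_continuous R n n i j)
  (metric_smooth g a)).
Qed.

Lemma inv_metric_smooth i j :
  smooth_in (chart a) (fun p => inv_metric g a p i j).
Proof.
apply: smooth_in_invmx => //; first exact: metric_unitmx.
exact: metric_entry_smooth.
Qed.

Lemma pder_smooth i (h : M -> R) :
  smooth_in (chart a) h -> smooth_in (chart a) (pder a i h).
Proof. exact: smooth_in_der_cst. Qed.

Lemma christoffel_smooth i j h :
  smooth_in (chart a) (christoffel g a i j h).
Proof.
apply: smooth_in_mul => //; first exact: smooth_in_cst.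
apply: smooth_in_sum => // m _; apply: smooth_in_mul => //.
  exact: inv_metric_smooth.
have sg k u v : smooth_in (chart a) (pder a k (fun x => metric g a x u v)).
  exact/pder_smooth/metric_entry_smooth.
by apply: smooth_in_sub => //; apply: smooth_in_add.
Qed.

Lemma christoffel_sym i j h p : chart_dom (chart a) p ->
  christoffel g a i j h p = christoffel g a j i h p.
Proof.
move=> ap; apply: (congr1 ( *%R 2^-1)); apply: eq_bigr => m _.
apply: (f_equal2 (fun x y => inv_metric g a p h m * (x - y))).
  exact: addrC.
by apply: der_eq => // q aq; rewrite -[in LHS](Defs.metric_sym g aq) mxE.
Qed.

Lemma fA_smooth j i h : smooth_fun f -> smooth_in (chart a) (fA g f a j i h).
Proof.
move=> sf; have sd k : smooth_in (chart a) (pder a k f) by apply: pder_smooth.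
have sC r : smooth_in (chart a) (fun=> r : R) by exact: smooth_in_cst.
apply: smooth_in_sub => //.
  by apply: smooth_in_add => //; apply: smooth_in_mul.
apply: smooth_in_mul => //; last exact: metric_entry_smooth.
apply: smooth_in_sum => // m _; apply: smooth_in_mul => //.
exact: inv_metric_smooth.
Qed.

Lemma scaled_fA_smooth j i h : smooth_fun f -> (forall p, 0 < f p) ->
  smooth_in (chart a) (fun p => (2 * f p)^-1 * fA g f a j i h p).
Proof.
move=> sf f0; apply: smooth_in_mul => //; last exact: fA_smooth.
apply: smooth_in_inv => //.
  by move=> p _; rewrite mulf_neq0 ?pnatr_eq0 // gt_eqF.
by apply: smooth_in_mul => //; apply: smooth_in_cst.
Qed.

Lemma levi_civita_coord (k : 'I_n) (Y : M -> 'rV[R]_n) p :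
  chart_dom (chart a) p -> smooth_in (chart a) Y ->
  levi_civita g a (@coord_field R n M k) Y p =
  \row_h (pder a k (fun q => Y q 0 h) p
          + \sum_s Y p 0 s * christoffel g a k s h p).
Proof.
move=> ap sY; apply/rowP => h; rewrite !mxE; congr (_ + _).
  exact: esym (der_linear rc _ (@mx_entry_continuous R 1 n 0 h) ap sY).
rewrite (bigD1 k) //= [X in _ + X]big1 ?addr0.
  by apply: eq_bigr => s _; rewrite mxE !eqxx mul1r.
by move=> i ik; rewrite big1 // => j _; rewrite mxE (negPf ik) andbF !mul0r.
Qed.

Lemma levi_civita_coord_coord k j p : chart_dom (chart a) p ->
  levi_civita g a (@coord_field R n M k) (@coord_field R n M j) p =
  \row_h christoffel g a k j h p.
Proof.
move=> ap; rewrite levi_civita_coord //; last exact: smooth_in_cst.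
apply/rowP => h; rewrite !mxE /pder (der_cst rc) // add0r.
rewrite (bigD1 j) //= [X in _ + X]big1 ?addr0.
  by rewrite mxE !eqxx mul1r.
by move=> i ij; rewrite mxE (negPf ij) andbF mul0r.
Qed.

Lemma levi_civita_coord2 m l j p : chart_dom (chart a) p ->
  levi_civita g a (@coord_field R n M m)
    (levi_civita g a (@coord_field R n M l) (@coord_field R n M j)) p =
  \row_h (pder a m (christoffel g a l j h) p
    + \sum_s christoffel g a l j s p * christoffel g a m s h p).
Proof.
move=> ap.
have sY : smooth_in (chart a) (fun q => \row_h christoffel g a l j h q).
  by apply: smooth_in_row => // h; apply: christoffel_smooth.
have E : field_eq (chart a) (fun q => \row_h christoffel g a l j h q)
    (levi_civita g a (@coord_field R n M l) (@coord_field R n M j)).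
  by move=> q aq; rewrite levi_civita_coord_coord.
rewrite levi_civita_coord //; last exact: smooth_in_eq E sY.
apply/rowP => h; rewrite [LHS]mxE [RHS]mxE; congr (_ + _).
  by apply: der_eq => // q aq; rewrite -E // mxE.
by apply: eq_bigr => s _; rewrite -E // mxE.
Qed.

Lemma levi_civita_bracket_coord m l j p : chart_dom (chart a) p ->
  levi_civita g a (lie_bracket (chart a) (@coord_field R n M m)
    (@coord_field R n M l)) (@coord_field R n M j) p = 0.
Proof.
move=> ap; rewrite /levi_civita (der_cst rc) // add0r.
have -> : lie_bracket (chart a) (@coord_field R n M m) (@coord_field R n M l) p
    = 0.
  by rewrite /lie_bracket !(der_cst rc) // subrr.
apply/rowP => h; rewrite [LHS]mxE [RHS]mxE big1 // => i _.
by rewrite big1 // => k _; rewrite mxE !mul0r.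
Qed.

(** The classical coordinate formula; the bracket of coordinate fields
    vanishes. *)
Lemma riemannE m l j r p : chart_dom (chart a) p ->
  riemann g a m l j r p =
  pder a m (christoffel g a l j r) p - pder a l (christoffel g a m j r) p
  + \sum_s christoffel g a l j s p * christoffel g a m s r p
  - \sum_s christoffel g a m j s p * christoffel g a l s r p.
Proof.
move=> ap; rewrite /riemann /curvature.
rewrite (levi_civita_coord2 m l j ap) (levi_civita_coord2 l m j ap).
rewrite levi_civita_bracket_coord // subr0 mxE [X in X + _]mxE [X in _ + X]mxE.
rewrite [X in _ - X]mxE.
by rewrite opprD addrACA addrA.
Qed.

End Coefficients.

(** * Algebra of the curvature coefficients *)

Section Algebra.
Context {F : comNzRingType} {n : nat}.

(** Quadratic expansion behind the curvature of a connection G + S that deforms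
    a torsion-free G.  In the application the derivative terms dG, dS and all
    products are taken at one point; Gml s stands for both G_ml^s and G_lm^s,
    whence the two terms with Gml, which complete the covariant derivatives of
    S, cancel. *)
Lemma curvature_deformation (dG dG' dS dS' : F)
    (Glj Gmj Gml Gm Gl Slj Smj Sm Sl Sj : 'I_n -> F) :
  (dG + dS) - (dG' + dS') + \sum_s (Glj s + Slj s) * (Gm s + Sm s)
    - \sum_s (Gmj s + Smj s) * (Gl s + Sl s)
  = (dG - dG' + \sum_s Glj s * Gm s - \sum_s Gmj s * Gl s)
    + (dS + \sum_s Gm s * Slj s - \sum_s Gml s * Sj s - \sum_s Gmj s * Sl s)
    - (dS' + \sum_s Gl s * Smj s - \sum_s Gml s * Sj s - \sum_s Glj s * Sm s)
    + \sum_s Sm s * Slj s - \sum_s Sl s * Smj s.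
Proof.
have E (A B A' B' : 'I_n -> F) : \sum_s (A s + A' s) * (B s + B' s) =
    \sum_s A s * B s + \sum_s B s * A' s + \sum_s A s * B' s
    + \sum_s B' s * A' s.
  by rewrite -!big_split /=; apply: eq_bigr => s _; ring.
by rewrite !E; ring.
Qed.

Lemma sum_delta (x : 'I_n -> F) j : \sum_w x w * (w == j)%:R = x j.
Proof.
rewrite (bigD1 j) //= eqxx mulr1 big1 ?addr0 // => w wj.
by rewrite (negPf wj) mulr0.
Qed.

Lemma sum_delta_sym (x : 'I_n -> F) j : \sum_w x w * (j == w)%:R = x j.
Proof. by under eq_bigr => w _ do rewrite eq_sym; rewrite sum_delta. Qed.

(** G acts on the tensor product of a space and its dual as
    G (x) 1 - 1 (x) G^t, and likewise for H; this composes the two actions.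
    The two mixed terms are exchanged when G and H are, hence disappear from
    commutators. *)
Lemma tensor_connection_sq (G H : 'I_n -> 'I_n -> F) i j v r :
  \sum_q (G i q.1 * (q.2 == j)%:R - G q.2 j * (q.1 == i)%:R)
       * (H q.1 v * (r == q.2)%:R - H r q.2 * (v == q.1)%:R)
  = (\sum_u G i u * H u v) * (r == j)%:R - G i v * H r j - G r j * H i v
    + (\sum_w H r w * G w j) * (v == i)%:R.
Proof.
pose X q : F := (G i q.1 * (q.2 == j)%:R - G q.2 j * (q.1 == i)%:R)
       * (H q.1 v * (r == q.2)%:R - H r q.2 * (v == q.1)%:R).
rewrite -(pair_bigA _ (fun u w => X (u, w))) /X /=.
have E u w : (G i u * (w == j)%:R - G w j * (u == i)%:R)
       * (H u v * (r == w)%:R - H r w * (v == u)%:R) =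
   G i u * H u v * (w == j)%:R * (r == w)%:R
   - (G i u * H r w * (w == j)%:R) * (v == u)%:R
   - (G w j * H u v * (u == i)%:R) * (r == w)%:R
   + H r w * G w j * (u == i)%:R * (v == u)%:R by ring.
under eq_bigr => u _.
  under eq_bigr => w _ do rewrite E.
  rewrite big_split /= !sumrB !sum_delta_sym -!mulr_suml sum_delta.
  over.
rewrite big_split /= !sumrB -!mulr_suml sum_delta_sym sum_delta.
by rewrite sum_delta_sym.
Qed.

Lemma tensor_curvature_regroup
    (A A' B B' S S' T T' x1 x2 x3 x4 d e : F) :
  A * d - B * e - (A' * d - B' * e) + (S * d - x1 * x2 - x3 * x4 + T * e)
    - (S' * d - x4 * x3 - x2 * x1 + T' * e)
  = (A - A' + S - S') * d - (B - B' + T' - T) * e.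
Proof. by ring. Qed.

End Algebra.

(** * The adapted frame and the metric connection *)

Section AdaptedFrame.
Context {R : realType} {n : nat} (M : smooth_manifold R n).
Variables (g : riemannian_metric M) (f : M -> R) (a : atlas M).
Hypotheses (f_smooth : smooth_fun f) (f_pos : forall p, 0 < f p).

Local Notation index := ('I_n + 'I_n * 'I_n)%type.
Let rc := manifold_chart_regular a.
Let rt := tchart_regular a.

(** Together with frame_coef, the expression of the adapted frame in the natural
    frame of the induced chart: a constant vector plus a vertical one. *)
Definition frame_const (al : index) : 'rV[R]_n * 'M[R]_n :=
  match al with
  | inl l => (delta_mx 0 l, 0)
  | inr (i, j) => (0, delta_mx i j)
  end.

Definition frame_coef (al : index) (ij : 'I_n * 'I_n) (t : tensor11 M) : R :=
  if al is inl l then hlift_fibre g a t (delta_mx 0 l) ij.1 ij.2 else 0.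

Lemma frame_decomp al t : frame g a al t =
  frame_const al + \sum_ij frame_coef al ij t *: frame_const (inr ij).
Proof.
case: al => [l|[i j]] /=; last first.
  by rewrite big1 ?addr0 // => ij _; rewrite scale0r.
have -> : \sum_ij hlift_fibre g a t (delta_mx 0 l) ij.1 ij.2 *:
      frame_const (inr ij) =
    \sum_i \sum_j hlift_fibre g a t (delta_mx 0 l) i j *:
      ((0, delta_mx i j) : 'rV[R]_n * 'M[R]_n).
  by rewrite pair_bigA; apply: eq_bigr => -[i j].
apply/eqP; rewrite -pair_eqE /=; apply/andP; split; apply/eqP.
  rewrite (linear_sum fst) big1 ?addr0 // => i _.
  by rewrite (linear_sum fst) big1 // => j _ /=; rewrite scaler0.
rewrite add0r (linear_sum snd) [LHS]matrix_sum_delta; apply: eq_bigr => i _.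
by rewrite (linear_sum snd).
Qed.

Lemma frame_coef_smooth al ij : smooth_in (tchart a) (frame_coef al ij).
Proof.
case: al => [l|kl] /=; last exact: smooth_in_cst.
have sG s i j : smooth_in (tchart a) (fun t => christoffel g a s i j (tbase t)).
  exact/smooth_in_pullback/christoffel_smooth.
have sH : smooth_in (tchart a) (fun t => \sum_(s < n)
    (delta_mx 0 l : 'rV[R]_n) 0 s * \sum_(m < n)
    (christoffel g a s ij.2 m (tbase t) * tcomp t a ij.1 m
     - christoffel g a s m ij.1 (tbase t) * tcomp t a m ij.2)).
  apply: smooth_in_sum => // s _; apply: smooth_in_mul => //.
    exact: smooth_in_cst.
  apply: smooth_in_sum => // m _; apply: smooth_in_sub => //;
    by apply: smooth_in_mul => //; apply: smooth_in_tcomp.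
by apply: smooth_in_eq sH => t _; rewrite /= mxE.
Qed.

Lemma frame_smooth al : smooth_in (tchart a) (frame g a al).
Proof.
have sF : smooth_in (tchart a) (fun t => frame_const al +
    \sum_ij frame_coef al ij t *: frame_const (inr ij)).
  apply: smooth_in_add => //; first exact: smooth_in_cst.
  apply: smooth_in_sum => // ij _; apply: smooth_in_scale => //.
    exact: frame_coef_smooth.
  exact: smooth_in_cst.
by apply: smooth_in_eq sF => t _; rewrite frame_decomp.
Qed.

Lemma der_frame_smooth al (h : tensor11 M -> R) :
  smooth_in (tchart a) h ->
  smooth_in (tchart a) (der (tchart a) (frame g a al) h).
Proof.
move=> sh; apply: (smooth_in_der rt _ (frame_decomp al)) => // ij.
exact: frame_coef_smooth.
Qed.

Lemma der_frame al be t : chart_dom (tchart a) t ->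
  der (tchart a) (frame g a al) (frame g a be) t =
  \sum_ij der (tchart a) (frame g a al) (frame_coef be ij) t
    *: frame_const (inr ij).
Proof.
move=> at_.
have sc v : smooth_in (tchart a) (fun=> v : 'rV[R]_n * 'M[R]_n).
  exact: smooth_in_cst.
have sk ij : smooth_in (tchart a)
    (fun u => frame_coef be ij u *: frame_const (inr ij)).
  by apply: smooth_in_scale => //; apply: frame_coef_smooth.
rewrite (der_eq (h' := fun u => frame_const be +
    \sum_ij frame_coef be ij u *: frame_const (inr ij)) erefl); last first.
  by move=> u _; apply: frame_decomp.
rewrite (derD rt) //; last exact: smooth_in_sum.
rewrite (der_cst rt) // add0r (der_sum rt) //; apply: eq_bigr => ij _.
rewrite (derZ rt) //; last exact: frame_coef_smooth.
by rewrite (der_cst rt) // scaler0 addr0.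
Qed.

Definition bracket_coef al be (ij : 'I_n * 'I_n) (t : tensor11 M) : R :=
  der (tchart a) (frame g a al) (frame_coef be ij) t
  - der (tchart a) (frame g a be) (frame_coef al ij) t.

Lemma bracket_coef_smooth al be ij :
  smooth_in (tchart a) (bracket_coef al be ij).
Proof.
by apply: smooth_in_sub => //; apply/der_frame_smooth/frame_coef_smooth.
Qed.

(** The bracket of two adapted frame fields is vertical, since their base
    components are constant; its coefficients need not be computed. *)
Lemma frame_bracket al be : field_eq (tchart a)
  (lie_bracket (tchart a) (frame g a al) (frame g a be))
  (fun t => \sum_ij bracket_coef al be ij t *: frame g a (inr ij) t).
Proof.
move=> t at_; rewrite /lie_bracket !der_frame // -sumrB.
by apply: eq_bigr => -[i j] _; rewrite -scalerBl.
Qed.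

Definition scaled_fA (i k h : 'I_n) (p : M) : R :=
  (2 * f p)^-1 * fA g f a i k h p.

(** The structure functions of the metric connection in the adapted frame only
    depend on the base point, so they are defined on M. *)
Definition conn_coef (al be ga : index) (p : M) : R :=
  match al, be, ga with
  | inl l, inl j, inl r => christoffel g a l j r p + scaled_fA l j r p
  | inl l, inr (i, j), inr (v, r) =>
      christoffel g a l i v p * (r == j)%:R
      - christoffel g a l r j p * (v == i)%:R
  | _, _, _ => 0
  end.

Lemma conn_coef_smooth al be ga : smooth_in (chart a) (conn_coef al be ga).
Proof.
have s0 (r : R) : smooth_in (chart a) (fun=> r) by exact: smooth_in_cst.
case: al be ga => [l|[? ?]] [j|[i j]] [r|[v r]]; rewrite /conn_coef //.
  apply: smooth_in_add => //; first exact: christoffel_smooth.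
  exact: scaled_fA_smooth.
by apply: smooth_in_sub => //; apply: smooth_in_mul => //;
  apply: christoffel_smooth.
Qed.

Lemma der_frame_base al (h : M -> R) t : chart_dom (tchart a) t ->
  smooth_in (chart a) h ->
  der (tchart a) (frame g a al) (fun u => h (tbase u)) t =
  if al is inl m then pder a m h (tbase t) else 0.
Proof.
move=> at_ sh; rewrite der_pullback //.
by case: al => [m|[i j]] //=; rewrite /der derive0.
Qed.

Lemma pder_add m (h k : M -> R) p : chart_dom (chart a) p ->
  smooth_in (chart a) h -> smooth_in (chart a) k ->
  pder a m (fun q => h q + k q) p = pder a m h p + pder a m k p.
Proof. exact: derD. Qed.

Lemma pder_mulr m (h : M -> R) (b : R) p : chart_dom (chart a) p ->
  smooth_in (chart a) h ->
  pder a m (fun q => h q * b) p = pder a m h p * b.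
Proof.
move=> ap sh.
have sb : smooth_in (chart a) (fun=> b : R) by exact: smooth_in_cst.
apply: etrans (derZ rc _ ap sh sb) _.
by rewrite (der_cst rc) // scaler0 addr0.
Qed.

Lemma pder_sub m (h k : M -> R) p : chart_dom (chart a) p ->
  smooth_in (chart a) h -> smooth_in (chart a) k ->
  pder a m (fun q => h q - k q) p = pder a m h p - pder a m k p.
Proof.
move=> ap sh sk; apply: etrans (pder_add m ap sh (smooth_in_opp rc sk)) _.
congr (_ + _); have := pder_mulr m (-1) ap sk; rewrite mulrN1 => <-.
by apply: der_eq => // q _; rewrite mulrN1.
Qed.

Variable D : (tensor11 M -> ('rV[R]_n * 'M[R]_n)%type) ->
  (tensor11 M -> ('rV[R]_n * 'M[R]_n)%type) ->
  (tensor11 M -> ('rV[R]_n * 'M[R]_n)%type).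
Hypothesis D_metric : sasaki_metric_connection g f a D.

Let aD := smc_affine D_metric.

Lemma conn_frame al be : field_eq (tchart a)
  (D (frame g a al) (frame g a be))
  (fun t => \sum_ga conn_coef al be ga (tbase t) *: frame g a ga t).
Proof.
move=> t at_; rewrite big_sumType /=.
case: al be => [l|[c l]] [j|[i j]] /=.
- rewrite (smc_HH D_metric) // [X in _ = _ + X]big1 ?addr0 //.
  by move=> ? _; rewrite scale0r.
- rewrite (smc_HV D_metric) // [X in _ = X + _]big1 ?add0r; last first.
    by move=> ? _; rewrite scale0r.
  by rewrite pair_bigA; apply: eq_bigr => -[v r] _.
- by rewrite (smc_VH D_metric) // !big1 ?addr0 // => ? _; rewrite scale0r.
- by rewrite (smc_VV D_metric) // !big1 ?addr0 // => ? _; rewrite scale0r.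
Qed.

Lemma conn_vertical_frame ij ga t : chart_dom (tchart a) t ->
  D (frame g a (inr ij)) (frame g a ga) t = 0.
Proof.
by move=> at_; rewrite conn_frame // big1 // => de _; rewrite scale0r.
Qed.

(** The bracket is a smooth combination of vertical frame fields, along which
    the connection annihilates the frame. *)
Lemma conn_bracket al be ga t : chart_dom (tchart a) t ->
  D (lie_bracket (tchart a) (frame g a al) (frame g a be)) (frame g a ga) t = 0.
Proof.
move=> at_; have sE := frame_smooth.
have sS : smooth_in (tchart a)
    (fun t => \sum_ij bracket_coef al be ij t *: frame g a (inr ij) t).
  apply: smooth_in_sum => // ij _; apply: smooth_in_scale => //.
  exact: bracket_coef_smooth.
have E : field_eq (tchart a)
    (fun t => \sum_ij bracket_coef al be ij t *: frame g a (inr ij) t)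
    (lie_bracket (tchart a) (frame g a al) (frame g a be)).
  by move=> u au; rewrite frame_bracket.
rewrite -(conn_eql rt aD sS (sE ga) at_ E) (conn_combinationl rt aD) //.
  by rewrite big1 // => ij _; rewrite conn_vertical_frame // scaler0.
by move=> ij; apply: bracket_coef_smooth.
Qed.

(** Structure functions live on M, so a vertical field differentiates them to
    0 and the horizontal lift of a coordinate field acts on them
    as that field does. *)
Definition curv_coef (al be ga de : index) (p : M) : R :=
  (if al is inl m then pder a m (conn_coef be ga de) p else 0)
  - (if be is inl l then pder a l (conn_coef al ga de) p else 0)
  + \sum_s conn_coef be ga s p * conn_coef al s de p
  - \sum_s conn_coef al ga s p * conn_coef be s de p.

Lemma frame_curvature al be ga t : chart_dom (tchart a) t ->
  curvature (tchart a) D (frame g a al) (frame g a be) (frame g a ga) t =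
  \sum_de curv_coef al be ga de (tbase t) *: frame g a de t.
Proof.
move=> at_.
rewrite (curvature_frame rt aD frame_smooth
  (fun i j k => smooth_in_pullback (conn_coef_smooth i j k)) conn_frame) //.
rewrite conn_bracket // subr0; apply: eq_bigr => de _.
by rewrite !der_frame_base //; apply: conn_coef_smooth.
Qed.

Lemma curv_coef_vertical al be ga de p : chart_dom (chart a) p ->
  vertical_index al || vertical_index be -> curv_coef al be ga de p = 0.
Proof.
move=> ap.
have d0 (m : 'I_n) : pder a m (fun=> 0 : R) p = 0 by rewrite /pder (der_cst rc).
by case: al be => [m|c1] [l|c2] //= _; rewrite /curv_coef /= ?d0;
  rewrite !big1 ?subr0 ?addr0 ?subr0 // => s _; rewrite ?mul0r ?mulr0.
Qed.

Lemma curv_coef_HH m l j r p : chart_dom (chart a) p ->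
  curv_coef (inl m) (inl l) (inl j) (inl r) p =
  riemann g a m l j r p
  + cov12 g a scaled_fA m l j r p - cov12 g a scaled_fA l m j r p
  + \sum_s scaled_fA m s r p * scaled_fA l j s p
  - \sum_s scaled_fA l s r p * scaled_fA m j s p.
Proof.
move=> ap; have sG := christoffel_smooth g a.
have sS u v w : smooth_in (chart a) (scaled_fA u v w).
  exact: scaled_fA_smooth.
rewrite /curv_coef !big_sumType /=.
rewrite (pder_add _ ap (sG l j r) (sS l j r)).
rewrite (pder_add _ ap (sG m j r) (sS m j r)).
rewrite [X in _ + (_ + X) - _]big1; last by move=> ? _; rewrite mul0r.
rewrite [X in _ + _ - (_ + X)]big1; last by move=> ? _; rewrite mul0r.
rewrite !addr0 riemannE // /cov12.
(* absence of torsion: the middle terms of the covariant derivatives agree *)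
under [X in _ = _ - (_ + _ - X - _) + _ - _]eq_bigr => s _ do
  rewrite (christoffel_sym g l m s ap).
exact: curvature_deformation.
Qed.

(** The connection preserves the horizontal and the vertical distributions. *)
Lemma conn_coef_mixed al be ga :
  vertical_index be != vertical_index ga -> conn_coef al be ga = fun=> 0.
Proof.
move=> bg; apply/funext => p.
by case: al be ga bg => [l|[? ?]] [j|[i j]] [r|[v r]].
Qed.

Lemma curv_coef_mixed al be ga de p : chart_dom (chart a) p ->
  vertical_index ga != vertical_index de -> curv_coef al be ga de p = 0.
Proof.
move=> ap gd; rewrite /curv_coef !(conn_coef_mixed _ gd).
have d0 (m : 'I_n) : pder a m (fun=> 0 : R) p = 0 by exact: der_cst.
have dz (x : index) : (if x is inl m then pder a m (fun=> 0) p else 0) = 0.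
  by case: x.
have s0 x y : \sum_s conn_coef x ga s p * conn_coef y s de p = 0.
  apply: big1 => s _.
  have [gs|gs] := eqVneq (vertical_index ga) (vertical_index s).
    by rewrite (conn_coef_mixed y (be := s)) ?mulr0 // -gs.
  by rewrite (conn_coef_mixed x gs) mul0r.
by rewrite !dz !s0 addr0 !subrr.
Qed.

(** The action on vertical fields is that of the Levi-Civita connection on
    (1,1)-tensors, whose curvature acts as a derivation. *)
Lemma curv_coef_HV m l i j v r p : chart_dom (chart a) p ->
  curv_coef (inl m) (inl l) (inr (i, j)) (inr (v, r)) p =
  riemann g a m l i v p * (r == j)%:R - riemann g a m l r j p * (v == i)%:R.
Proof.
move=> ap; have sG := christoffel_smooth g a.
have sGb u w x (b : bool) :
    smooth_in (chart a) (fun q => christoffel g a u w x q * b%:R).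
  by apply: smooth_in_mul => //; apply: smooth_in_cst.
have dC x y : pder a x (conn_coef (inl y) (inr (i, j)) (inr (v, r))) p =
    pder a x (christoffel g a y i v) p * (r == j)%:R
    - pder a x (christoffel g a y r j) p * (v == i)%:R.
  apply: etrans (pder_sub _ ap (sGb y i v (r == j)) (sGb y r j (v == i))) _.
  by rewrite (pder_mulr _ _ ap (sG y i v)) (pder_mulr _ _ ap (sG y r j)).
have sC x y : \sum_s conn_coef (inl x) (inr (i, j)) s p *
      conn_coef (inl y) s (inr (v, r)) p =
    (\sum_u christoffel g a x i u p * christoffel g a y u v p) * (r == j)%:R
    - christoffel g a x i v p * christoffel g a y r j p
    - christoffel g a x r j p * christoffel g a y i v p
    + (\sum_w christoffel g a y r w p * christoffel g a x w j p) * (v == i)%:R.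
  rewrite big_sumType [X in X + _ = _]big1 ?add0r; last first.
    by move=> s _; rewrite mul0r.
  apply: etrans (tensor_connection_sq (fun i u => christoffel g a x i u p)
    (fun i u => christoffel g a y i u p) i j v r).
  by apply: eq_bigr => -[u w] _.
apply: etrans (f_equal2 (fun x y => x - y) (f_equal2 +%R
  (f_equal2 (fun x y => x - y) (dC m l) (dC l m)) (sC l m)) (sC m l)) _.
rewrite (riemannE g m l i v ap) (riemannE g m l r j ap).
exact: tensor_curvature_regroup.
Qed.

Lemma scaled_fA_mul u v w x y z p : scaled_fA u v w p * scaled_fA x y z p =
  (4 * f p ^+ 2)^-1 * fA g f a u v w p * fA g f a x y z p.
Proof.
rewrite /scaled_fA (_ : 4 * f p ^+ 2 = (2 * f p) * (2 * f p)); last by ring.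
by rewrite (invfM (2 * f p)) mulrACA !mulrA.
Qed.

End AdaptedFrame.

(** * Curvature of the metric connection *)

Theorem proposition4 (R : realType) (n : nat) (M : smooth_manifold R n)
    (g : riemannian_metric M) (f : M -> R)
    (f_smooth : smooth_fun f) (f_pos : forall p, 0 < f p)
    (a : atlas M)
    (D : (tensor11 M -> ('rV[R]_n * 'M[R]_n)%type) ->
         (tensor11 M -> ('rV[R]_n * 'M[R]_n)%type) ->
         (tensor11 M -> ('rV[R]_n * 'M[R]_n)%type))
    (D_metric : sasaki_metric_connection g f a D) :
  [/\ forall m l j : 'I_n,
        field_eq (tchart a)
          (curvature (tchart a) D (EH g a m) (EH g a l) (EH g a j))
          (fun t => let p := tbase t in
            \sum_(r < n)
              (riemann g a m l j r p
               + cov12 g a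
                   (fun i k h x => (2 * f x)^-1 * fA g f a i k h x) m l j r p
               - cov12 g a
                   (fun i k h x => (2 * f x)^-1 * fA g f a i k h x) l m j r p
               + \sum_(s < n)
                   (4 * f p ^+ 2)^-1 * fA g f a m s r p * fA g f a l j s p
               - \sum_(s < n)
                   (4 * f p ^+ 2)^-1 * fA g f a l s r p * fA g f a m j s p)
              *: EH g a r t),
      forall m l i j : 'I_n,
        field_eq (tchart a)
          (curvature (tchart a) D (EH g a m) (EH g a l) (@EV R n M i j))
          (fun t => let p := tbase t in
            \sum_(v < n) \sum_(r < n)
              (riemann g a m l i v p * (r == j)%:R
               - riemann g a m l r j p * (v == i)%:R) *: @EV R n M v r t)
    & forall al be ga : 'I_n + 'I_n * 'I_n,
        vertical_index al || vertical_index be ->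
        field_eq (tchart a)
          (curvature (tchart a) D (frame g a al) (frame g a be)
             (frame g a ga))
          (fun=> 0)].
Proof.
split.
- move=> m l j t at_.
  apply: etrans (frame_curvature f_smooth f_pos D_metric
    (inl m) (inl l) (inl j) at_) _.
  rewrite big_sumType [X in _ + X = _]big1 ?addr0 /=; last first.
    by move=> c _; rewrite curv_coef_mixed ?scale0r.
  apply: eq_bigr => r _; apply: (congr1 ( *:%R^~ _)).
  apply: etrans (curv_coef_HH g f_smooth f_pos m l j r at_) _.
  by apply: (f_equal2 (fun x y => x - y)); last apply: eq_bigr => s _;
    first (apply: (congr1 (+%R _)); apply: eq_bigr => s _);
    apply: scaled_fA_mul.
- move=> m l i j t at_.
  apply: etrans (frame_curvature f_smooth f_pos D_metric
    (inl m) (inl l) (inr (i, j)) at_) _.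
  rewrite big_sumType [X in X + _ = _]big1 ?add0r /=; last first.
    by move=> r _; rewrite curv_coef_mixed ?scale0r.
  rewrite pair_bigA; apply: eq_bigr => -[v r] _.
  apply: (congr1 ( *:%R^~ _)); exact: (curv_coef_HV g f m l i j v r at_).
- move=> al be ga vert t at_.
  rewrite (frame_curvature f_smooth f_pos D_metric al be ga at_).
  by rewrite big1 // => de _; rewrite curv_coef_vertical ?scale0r.
Qed.
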